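(* Consider a finite MDP with state space $\mathcal S$, action space $\mathcal A$, transition kernel $P$, deterministic reward function $r(s,a,s')$, discount $\gamma\in[0,1)$ and optimal Q-function $Q^*$. Let $\beta>0$. Let $(s_k,a_k,s_k')_{k\ge0}$ be i.i.d. triples where $s_k\sim p$ for a fixed state distribution $p$, $a_k\sim b(\cdot\mid s_k)$ for a fixed behavior policy $b$, and $s_k'\sim P(\cdot\mid s_k,a_k)$, and assume $d(s,a):=p(s)b(a\mid s)>0$ for all $(s,a)$. Let $Q^A_0,Q^B_0\in\mathbb R^{\mathcal S\times\mathcal A}$ be arbitrary and define (AGT2-QL) $$Q^A_{k+1}(s_k,a_k)=Q^A_k(s_k,a_k)+\alpha_k\Big(r(s_k,a_k,s_k')+\gamma\max_{a\in\mathcal A}Q^B_k(s_k',a)-Q^A_k(s_k,a_k)\Big),$$ $$Q^B_{k+1}(s_k,a_k)=Q^B_k(s_k,a_k)+\alpha_k\beta\big(Q^A_k(s_k,a_k)-Q^B_k(s_k,a_k)\big),$$ with all other entries of $Q^A_{k+1},Q^B_{k+1}$ equal to those of $Q^A_k,Q^B_k$. If the step sizes satisfy $0\le\alpha_k\le1$, $\sum_k\alpha_k=\infty$, $\sum_k\alpha_k^2<\infty$, then $Q^A_k\to Q^*$ and $Q^B_k\to Q^*$ with probability one.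
   Context: $Q^*$ is the unique solution of $Q^*(s,a)=\sum_{s'}P(s'\mid s,a)\big(r(s,a,s')+\gamma\max_{a'}Q^*(s',a')\big)$. There are no terminal states. *)

(* Defs.v *)
From HB Require Import structures.
From mathcomp Require Import all_boot all_order all_algebra.
From mathcomp Require Import all_classical all_reals all_analysis.
Set Implicit Arguments. Unset Strict Implicit. Unset Printing Implicit Defensive.
Import Order.TTheory GRing.Theory Num.Theory.
Import numFieldNormedType.Exports.
Local Open Scope classical_set_scope.
Local Open Scope ring_scope.

Section MDP.
Variables (R : realType) (S A : finType).

(* max_{a in A} f a  (A is assumed nonempty in a finite MDP; 0 if A is empty) *)
Definition maxA (f : A -> R) : R :=
  match [pick a : A] with
  | Some a0 => \big[Num.max/f a0]_(a : A) f a
  | None => 0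
  end.

Definition bellman_opt (P : S -> A -> S -> R) (r : S -> A -> S -> R) (gamma : R)
  (Q : S -> A -> R) : Prop :=
  forall s a, Q s a = \sum_(s' : S) P s a s' * (r s a s' + gamma * maxA (Q s')).

Definition agt2_step (r : S -> A -> S -> R) (gamma beta alpha : R)
  (x : S * A * S) (Q : (S -> A -> R) * (S -> A -> R)) : (S -> A -> R) * (S -> A -> R) :=
  let: (s, a, s') := x in
  let: (QA, QB) := Q in
  ((fun u v => if (u == s) && (v == a) then
                 QA s a + alpha * (r s a s' + gamma * maxA (QB s') - QA s a)
               else QA u v),
   (fun u v => if (u == s) && (v == a) then
                 QB s a + alpha * beta * (QA s a - QB s a)
               else QB u v)).

Fixpoint agt2 (r : S -> A -> S -> R) (gamma beta : R) (alpha : nat -> R)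
  (QA0 QB0 : S -> A -> R) (xs : nat -> S * A * S) (k : nat)
  : (S -> A -> R) * (S -> A -> R) :=
  match k with
  | 0 => (QA0, QB0)
  | k'.+1 => agt2_step r gamma beta (alpha k') (xs k')
               (agt2 r gamma beta alpha QA0 QB0 xs k')
  end.

Definition triple_law (p : S -> R) (b : S -> A -> R) (P : S -> A -> S -> R)
  (x : S * A * S) : R :=
  let: (s, a, s') := x in p s * b s a * P s a s'.

Definition iid_with_law {d} {T : measurableType d} (Pr : probability T R)
  (X : nat -> T -> S * A * S) (mu : S * A * S -> R) : Prop :=
  (forall k x, measurable (X k @^-1` [set x])) /\
  (forall (ks : seq nat) (x : nat -> S * A * S), uniq ks ->
     Pr (\big[setI/setT]_(k <- ks) (X k @^-1` [set x k])) =
     (\prod_(k <- ks) mu (x k))%:E).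

End MDP.

(* Main.v *)
(** Along a fixed trajectory the error of [Q^A] at [(s, a)] is averaged, with
    weights [alpha k * 1{(s_k, a_k) = (s, a)}], with a term bounded by [gamma]
    times the sup-norm error of [Q^B], up to an additive noise; the error of
    [Q^B] is averaged with that of [Q^A].  If the weights sum to infinity and
    the noise series converge, an asymptotic bound [c] on the error of [Q^B]
    thus yields the bound [gamma * c] for [Q^A] and then for [Q^B], and both
    errors tend to 0.

    Almost surely both conditions hold: the iterates are uniformly bounded, so
    the noise and [alpha k * (1{(s_k, a_k) = (s, a)} - d s a)] are martingale
    increments of size [O(alpha k)]; as [alpha] is square summable, their
    series converge by Kolmogorov's maximal inequality. *)

Require Import Defs.
From HB Require Import structures.
From mathcomp Require Import all_boot all_order all_algebra.
From mathcomp Require Import all_classical all_reals all_analysis.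
From mathcomp Require Import ring lra.
Import Order.TTheory GRing.Theory Num.Theory.
Import numFieldNormedType.Exports.
Local Open Scope classical_set_scope.
Local Open Scope ring_scope.

(** * Deterministic averaging recursions *)

Section Averaging.
Context {R : realType}.
Implicit Types (a h e u v : R^nat) (H : R).

(** Since [1 - a k <= expR (- a k)], the product of the factors decays like the exponential of minus
    the sum of the weights, which diverges. Only an upper bound is claimed, so [v] may be
    negative. *)
Lemma contraction_eventually_le a v (K : nat) :
  (forall k, (K <= k)%N -> 0 <= a k <= 1) ->
  series a @ \oo --> +oo ->
  (forall k, (K <= k)%N -> v k.+1 <= (1 - a k) * v k) ->
  forall eps, 0 < eps -> \forall n \near \oo, v n <= eps.
Proof.
move=> a01 suma vS eps eps0.
have vle n : v (K + n)%N <=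
    expR (series a K - series a (K + n)%N) * `|v K|.
  elim: n => [|n IH]; first by rewrite addn0 subrr expR0 mul1r ler_norm.
  rewrite addnS (le_trans (vS _ (leq_addr _ _)))//.
  have /andP[a0 a1] := a01 _ (leq_addr n K).
  rewrite (le_trans (ler_wpM2l _ IH)) ?subr_ge0// mulrA ler_wpM2r//.
  rewrite seriesSr opprD addrA [leRHS]expRD mulrC ler_wpM2l ?expR_ge0//.
  exact: expR_ge1Dx.
(* Past this threshold, [1 + t <= expR t] makes the exponential at least [|v K| / eps]. *)
have /cvgryPge/(_ (series a K + `|v K| / eps)) [N _ Nn] := suma.
exists (maxn K N) => // n /=; rewrite geq_max => /andP[Kn Nn'].
have := vle (n - K)%N; rewrite subnKC// => /le_trans; apply.
rewrite -opprB expRN mulrC ler_pdivrMr ?expR_gt0//.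
have := Nn _ Nn'; rewrite -lerBrDl => len.
have := expR_ge1Dx (series a n - series a K) => ge1.
have := normr_ge0 (v K) => vK0.
have : `|v K| / eps * eps <= expR (series a n - series a K) * eps.
  by rewrite ler_wpM2r ?ltW//; lra.
by rewrite mulfVK ?gt_eqF// mulrC.
Qed.

(** By the triangle inequality the excess [|u k| - H] obeys the contraction recursion once [a] and
    [h] satisfy their bounds. *)
Lemma averaging_eventually_le a h u H :
  (\forall k \near \oo, 0 <= a k <= 1) ->
  series a @ \oo --> +oo ->
  (forall k, u k.+1 = (1 - a k) * u k + a k * h k) ->
  (\forall k \near \oo, `|h k| <= H) ->
  forall eps, 0 < eps -> \forall n \near \oo, `|u n| <= H + eps.
Proof.
move=> [K1 _ a01] suma uS [K2 _ hH] eps eps0.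
have [N _ Nn] : \forall n \near \oo, `|u n| - H <= eps.
  apply: (@contraction_eventually_le a (fun k => `|u k| - H) (maxn K1 K2)) => //.
    by move=> k; rewrite geq_max => /andP[/a01].
  move=> k; rewrite geq_max => /andP[/a01/andP[a0 a1] /hH hk].
  rewrite uS (le_trans (lerB (ler_normD _ _) (lexx _)))// !normrM.
  rewrite [`|a k|]ger0_norm// [`|1 - a k|]ger0_norm ?subr_ge0//.
  have : a k * `|h k| <= a k * H by rewrite ler_wpM2l.
  lra.
by exists N => // n /Nn; rewrite lerBlDl.
Qed.

(* Subtracting the (vanishing) tail of [series e] from [u] absorbs the noise
   into the averaged term. *)
Lemma noisy_averaging_eventually_le a h e u H :
  (\forall k \near \oo, 0 <= a k <= 1) ->
  series a @ \oo --> +oo ->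
  cvgn (series e) ->
  (forall k, u k.+1 = (1 - a k) * u k + a k * h k + e k) ->
  (\forall k \near \oo, `|h k| <= H) ->
  forall eps, 0 < eps -> \forall n \near \oo, `|u n| <= H + eps.
Proof.
move=> a01 suma cve uS hH eps eps0.
pose t k := series e k - limn (series e).
have eps3 : 0 < eps / 3 by rewrite divr_gt0.
have [N _ tle] : \forall k \near \oo, `|t k| <= eps / 3.
  move: cve => /cvgrPdist_le/(_ _ eps3)[N _ HN].
  by exists N => // k /HN; rewrite distrC.
have [M _ Mle] : \forall n \near \oo, `|u n - t n| <= (H + eps / 3) + eps / 3.
  apply: (@averaging_eventually_le a (fun k => h k - t k)) => //.
  - by move=> k; rewrite uS /t seriesSr; ring.
  - move: hH => [N' _ hle]; exists (maxn N' N) => // k /=.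
    rewrite geq_max => /andP[/hle hk /tle tk].
    by rewrite (le_trans (ler_normB _ _))// lerD.
exists (maxn N M) => // n /=; rewrite geq_max => /andP[/tle tn /Mle un].
by have := ler_normD (u n - t n) (t n); rewrite subrK; lra.
Qed.

End Averaging.

(** * Almost sure convergence of series of martingale increments *)

Section AdaptedNoise.
Context {R : realType} {d : measure_display} {T : measurableType d}.
Context (Pr : probability T R) {Y : finType} (X : nat -> T -> Y) (mu : Y -> R).
Hypothesis measX : forall k y, measurable (X k @^-1` [set y]).
Hypothesis lawX : forall (ks : seq nat) (x : nat -> Y), uniq ks ->
  Pr (\big[setI/setT]_(k <- ks) (X k @^-1` [set x k])) =
  (\prod_(k <- ks) mu (x k))%:E.
Hypothesis mu_ge0 : forall y, 0 <= mu y.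
Hypothesis mu_sum1 : \sum_y mu y = 1.

Local Notation path w := (fun j => X j w).

Definition upd (x : nat -> Y) (k : nat) y : nat -> Y :=
  fun j => if j == k then y else x j.

Lemma bigsetU_finP (F : Y -> set T) w :
  (\big[setU/set0]_(y : Y) F y) w <-> exists y, F y w.
Proof.
rewrite -bigcup_seq; split=> [[y _ Fy]|[y Fy]]; exists y => //=.
by rewrite mem_index_enum.
Qed.

Lemma measure_finU_le (F : Y -> set T) : (forall y, measurable (F y)) ->
  (Pr (\big[setU/set0]_(y : Y) F y) <= \sum_(y : Y) Pr (F y))%E.
Proof.
move=> mF; elim: (index_enum Y) => [|y s IH].
  by rewrite !big_nil measure0.
rewrite !big_cons (le_trans (measureU2 _ _ _))//; last by rewrite leeD2l.
exact: bigsetU_measurable.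
Qed.

(** Splitting on the finitely many values of the last sample freezes that coordinate and shortens
    the horizon; at horizon 0 the predicate is constant. *)
Lemma measurable_finite_horizon n (B : (nat -> Y) -> bool) :
  (forall x x', (forall j, (j < n)%N -> x j = x' j) -> B x = B x') ->
  measurable [set w | B (path w)].
Proof.
elim: n B => [|n IH] B Bn.
  have [[w Bw]|nB] := pselect (exists w, B (path w)).
    rewrite (_ : [set _ | _] = setT) //; apply/seteqP; split=> // w' _ /=.
    by rewrite (Bn _ (path w)).
  rewrite (_ : [set _ | _] = set0) //; apply/seteqP; split=> // w' /= Bw'.
  by apply: nB; exists w'.
rewrite (_ : [set _ | _] = \big[setU/set0]_(y : Y)
    (X n @^-1` [set y] `&` [set w | B (upd (path w) n y)])).
  apply: bigsetU_measurable => y _; apply: measurableI => //.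
  apply: (IH (fun x => B (upd x n y))) => x x' xx'; apply: Bn => j.
  rewrite /upd ltnS leq_eqVlt; case: eqP => //= _; exact: xx'.
have updX w : upd (path w) n (X n w) = path w.
  by apply/funext => j; rewrite /upd; case: eqP => [->|].
apply/seteqP; split=> w /=.
  by move=> Bw; apply/bigsetU_finP; exists (X n w); split => //=; rewrite updX.
by move=> /bigsetU_finP[y [/= <-]]; rewrite updX.
Qed.

Definition cyl (x : nat -> Y) k :=
  \big[setI/setT]_(j <- iota 0 k) (X j @^-1` [set x j]).

Lemma cylP x k w : cyl x k w <-> forall j, (j < k)%N -> X j w = x j.
Proof.
rewrite /cyl -bigcap_seq; split=> [h j jk|h j /=].
  by apply: h; rewrite /= mem_iota.
by rewrite mem_iota /= add0n => /h.
Qed.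

Lemma measurable_cyl x k : measurable (cyl x k).
Proof. by apply: bigsetI_measurable. Qed.

Lemma measure_cyl x k : Pr (cyl x k) = (\prod_(j <- iota 0 k) mu (x j))%:E.
Proof. by rewrite lawX ?iota_uniq. Qed.

Lemma prod_updS x k y :
  \prod_(j <- iota 0 k.+1) mu (upd x k y j) =
  (\prod_(j <- iota 0 k) mu (x j)) * mu y.
Proof.
rewrite -addn1 iotaD big_cat big_seq1 /= add0n {2}/upd eqxx; congr (_ * _).
apply: eq_big_seq => j; rewrite mem_iota /= add0n /upd.
by case: eqP => // ->; rewrite ltnn.
Qed.

(** * Kolmogorov's maximal inequality *)

Section Maximal.
(** [g x k y] is the increment at time [k] when [y] is drawn after the past [x]; dependence on the
    coordinates below [k] only stands in for a filtration. *)
Variables (g : (nat -> Y) -> nat -> Y -> R) (c : R^nat) (eps : R).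
Hypothesis g_predictable : forall x x' k,
  (forall j, (j < k)%N -> x j = x' j) -> g x k = g x' k.
Hypothesis g_mean0 : forall x k, \sum_y mu y * g x k y = 0.
Hypothesis g_le : forall x k y, `|g x k y| <= c k.
Hypothesis eps_gt0 : 0 < eps.

Let c_ge0 (x : nat -> Y) k : 0 <= c k.
Proof. exact: le_trans (normr_ge0 _) (g_le x k (x 0%N)). Qed.

(** The walk at [s] at time [k] reaches modulus [eps] within [n] steps. Keeping position and time as
    parameters allows a restart after each sample. *)
Fixpoint exits (s : R) (k n : nat) (x : nat -> Y) : bool :=
  (eps <= `|s|) ||
  if n is n'.+1 then exits (s + g x k (x k)) k.+1 n' x else false.

Lemma exits_partial_sum n s k x m : (m <= n)%N ->
  eps <= `|s + \sum_(k <= j < k + m) g x j (x j)| -> exits s k n x.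
Proof.
elim: n s k m => [|n IH] s k [|m] //=.
- by rewrite addn0 big_geq// addr0 => _ ->.
- by rewrite addn0 big_geq// addr0 => _ ->.
- rewrite ltnS => mn h; apply/orP; right; apply: (IH _ _ m) => //.
  by move: h; rewrite big_ltn ?addrA ?addnS ?addSn// ltnS leq_addr.
Qed.

Lemma exits_mono n m s k x : (n <= m)%N -> exits s k n x -> exits s k m x.
Proof.
elim: n m s k => [|n IH] [|m] s k //=; first by rewrite orbF => _ ->.
by rewrite ltnS => nm /orP[->//|/(IH _ _ _ nm) ->]; rewrite orbT.
Qed.

Lemma exits_horizon s k n x x' :
  (forall j, (j < k + n)%N -> x j = x' j) -> exits s k n x = exits s k n x'.
Proof.
elim: n s k => [|n IH] s k xx' //=; congr (_ || _).
rewrite -(IH _ k.+1); last by rewrite addSnnS.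
rewrite (g_predictable _ x') ?xx'//.
  by rewrite -addSnnS ltn_addr.
by move=> j jk; apply: xx'; rewrite ltn_addr.
Qed.

Lemma measurable_exits s k n : measurable [set w | exits s k n (path w)].
Proof.
by apply: (@measurable_finite_horizon (k + n)) => x x'; exact: exits_horizon.
Qed.

(** The cross term of the square vanishes because the increment has mean zero. [B] will be the
    variance bound for the steps that remain. *)
Lemma second_moment_step x s k B :
  \sum_y mu y * ((s + g x k y) ^+ 2 + B) <= s ^+ 2 + c k ^+ 2 + B.
Proof.
have -> : \sum_y mu y * ((s + g x k y) ^+ 2 + B) =
    (s ^+ 2 + B) * (\sum_y mu y) + 2 * s * (\sum_y mu y * g x k y) +
    \sum_y mu y * g x k y ^+ 2.
  rewrite !mulr_sumr -!big_split /=; apply: eq_bigr => y _; ring.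
rewrite mu_sum1 g_mean0 mulr0 addr0 mulr1.
rewrite [leRHS](_ : _ = s ^+ 2 + B + (\sum_y mu y) * c k ^+ 2); last first.
  by rewrite mu_sum1; ring.
rewrite lerD2l mulr_suml ler_sum// => y _; rewrite ler_wpM2l//.
by rewrite -real_normK ?num_real// lerXn2r ?nnegrE ?c_ge0.
Qed.

(* Conditioning on the next sample, inside a cylinder fixing the past, makes the
   induction on the horizon work without stopping times or conditional
   expectations. *)
Lemma exits_cyl_le n s k x :
  (Pr (cyl x k `&` [set w | exits s k n (path w)]) <=
   ((\prod_(j <- iota 0 k) mu (x j)) *
    ((s ^+ 2 + \sum_(k <= j < k + n) c j ^+ 2) / eps ^+ 2))%:E)%E.
Proof.
elim: n s k x => [|n IH] s k x.
all: have prod_ge0 : 0 <= \prod_(j <- iota 0 k) mu (x j) by apply: prodr_ge0.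
all: have sum_ge0 m m' : 0 <= \sum_(m <= j < m') c j ^+ 2
  by apply: sumr_ge0 => j _; exact: sqr_ge0.
all: have eps2 : 0 < eps ^+ 2 by rewrite exprn_gt0.
all: have [ls|ls] := leP eps `|s|.
(* Already outside: the fraction is at least 1, so the probability of the cylinder suffices. *)
1,3: apply: (@le_trans _ _ (Pr (cyl x k)));
  [by rewrite le_measure ?inE//; [apply: measurableI;
     [exact: measurable_cyl|exact: measurable_exits] |exact: measurable_cyl]
  |rewrite measure_cyl lee_fin ler_peMr// ler_pdivlMr// mul1r;
   rewrite (@le_trans _ _ (s ^+ 2)) ?lerDl//;
   by rewrite -[leRHS]real_normK ?num_real// lerXn2r ?nnegrE// ltW].
- rewrite (_ : _ `&` _ = set0) ?measure0 ?lee_fin.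
    by rewrite mulr_ge0// divr_ge0 ?addr_ge0 ?sqr_ge0// ltW.
  by apply/seteqP; split=> // w [_] /=; rewrite orbF leNgt ls.
- set E := _ `&` _.
  (* Still inside, so the exit happens after the next sample [y], in a cylinder one step longer. On
     it the increment is the deterministic [g x k y], by predictability. *)
  pose F y := cyl (upd x k y) k.+1 `&`
    [set w | exits (s + g x k y) k.+1 n (path w)].
  have mF y : measurable (F y).
    by apply: measurableI; [exact: measurable_cyl|exact: measurable_exits].
  have EF : E `<=` \big[setU/set0]_(y : Y) F y.
    move=> w [/cylP xw] /=; rewrite leNgt ls /= => ew.
    apply/bigsetU_finP; exists (X k w); split => /=.
      apply/cylP => j; rewrite ltnS leq_eqVlt /upd.
      by case: eqP => [->//|_ /= /xw].
    by rewrite (g_predictable x (path w))// => j /xw ->.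
  apply: (le_trans (le_measure _ _ _ EF)); rewrite ?inE.
  - by apply: measurableI; [exact: measurable_cyl|exact: measurable_exits].
  - exact: bigsetU_measurable.
  apply: (le_trans (measure_finU_le _ mF)).
  apply: (le_trans (lee_sum _ (fun y _ => IH (s + g x k y) k.+1 (upd x k y)))).
  rewrite sumEFin lee_fin.
  rewrite (eq_bigr (fun y => \prod_(j <- iota 0 k) mu (x j) *
    ((mu y * ((s + g x k y) ^+ 2 + \sum_(k.+1 <= j < k.+1 + n) c j ^+ 2)) /
     eps ^+ 2))); last by move=> y _; rewrite prod_updS -!mulrA.
  rewrite -mulr_sumr ler_wpM2l//.
  rewrite -mulr_suml ler_wpM2r ?invr_ge0 ?(ltW eps2)//.
  rewrite [X in _ <= _ + X]big_ltn ?addnS ?addSn ?ltnS ?leq_addr// addrA.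
  exact: second_moment_step.
Qed.

Lemma maximal_inequality n :
  (Pr [set w | exits 0 0 n (path w)] <=
    ((\sum_(0 <= j < n) c j ^+ 2) / eps ^+ 2)%:E)%E.
Proof.
(* The cylinder bound needs a reference path; if none exists there is no outcome either. *)
have [x0|noY] := pselect (exists x : nat -> Y, True); last first.
  rewrite (_ : [set _ | _] = set0) ?measure0 ?lee_fin.
    by rewrite divr_ge0 ?sqr_ge0// sumr_ge0 // => j _; exact: sqr_ge0.
  by apply/seteqP; split=> // w _; apply: noY; exists (path w).
have [x _] := x0; have := exits_cyl_le n 0 0 x.
by rewrite /cyl /= !big_nil setTI mul1r expr0n add0r add0n.
Qed.

End Maximal.

(** The maximal inequality bounds the probability of a fluctuation of size [eps] after time [K] by
    the tail of the series of [c k ^+ 2] over [eps ^+ 2]. This vanishes as [K] grows, so almost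
    every path is Cauchy. *)
Lemma ae_cvg_adapted_series (g : (nat -> Y) -> nat -> Y -> R) (c : R^nat) :
  (forall x x' k, (forall j, (j < k)%N -> x j = x' j) -> g x k = g x' k) ->
  (forall x k, \sum_y mu y * g x k y = 0) ->
  (forall x k y, `|g x k y| <= c k) ->
  cvgn (series (fun k => c k ^+ 2)) ->
  {ae Pr, forall w, cvgn (series (fun k => g (path w) k (X k w)))}.
Proof.
move=> g_pred g_mean0 g_le c_cvg.
pose S := series (fun k => c k ^+ 2).
have S_le n : S n <= limn S.
  apply: nondecreasing_cvgn_le => // m m' mm'.
  rewrite /S /series /= (big_cat_nat (leq0n m) mm')//= lerDl.
  by apply: sumr_ge0 => i _; exact: sqr_ge0.
(* Silencing the first [K] increments turns the maximal inequality into a bound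
   on the fluctuations after time [K]. *)
pose h K x k y := if (k < K)%N then 0 else g x k y.
pose cK K k := if (k < K)%N then 0 else c k.
have h_pred K x x' k :
    (forall j, (j < k)%N -> x j = x' j) -> h K x k = h K x' k.
  by move=> xx'; apply/funext => y; rewrite /h (g_pred x x' k xx').
have h_mean0 K x k : \sum_y mu y * h K x k y = 0.
  have [kK|Kk] := ltnP k K.
    by rewrite big1// => y _; rewrite /h kK mulr0.
  rewrite -[RHS](g_mean0 x k); apply: eq_bigr => y _.
  by rewrite /h ltnNge Kk.
have h_le K x k y : `|h K x k y| <= cK K k.
  by rewrite /h /cK; case: ifP => _ //; rewrite normr0.
have cK_sum K n : \sum_(0 <= j < n) cK K j ^+ 2 <= limn S - S K.
  have [nK|/ltnW Kn] := leqP n K.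
    rewrite big_nat big1 ?subr_ge0// => i /= iN.
    by rewrite /cK (leq_trans iN nK) expr0n.
  rewrite (big_cat_nat (leq0n K) Kn)//= [X in X + _]big_nat big1 ?add0r.
    rewrite (eq_big_nat _ _ (F2 := fun j => c j ^+ 2)); last first.
      by move=> i /andP[Ki _]; rewrite /cK ltnNge Ki.
    rewrite lerBrDr (le_trans _ (S_le n))// /S /series /=.
    by rewrite (big_cat_nat (leq0n K) Kn)//= addrC.
  by move=> i /= iK; rewrite /cK iK expr0n.
(* Countably many thresholds, so that the exceptional sets have a negligible union. *)
pose eps (j : nat) : R := j.+1%:R^-1.
have eps0 j : 0 < eps j by rewrite invr_gt0.
pose E j K n := [set w | exits (h K) (eps j) 0 0 n (path w)].
have mE j K n : measurable (E j K n).
  exact: (measurable_exits _ _ (h_pred K)).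
pose B j K := \bigcup_n E j K n.
have mB j K : measurable (B j K) by exact: bigcupT_measurable.
have B_le j K : (Pr (B j K) <= ((limn S - S K) / eps j ^+ 2)%:E)%E.
  (* Continuity from below carries the bound, uniform in the horizon [n], to the infinite
     horizon. *)
  have cv : (Pr \o E j K) n @[n --> \oo] --> Pr (B j K).
    apply: nondecreasing_cvg_mu => [n||n m nm]; [exact: mE|exact: mB|].
    by apply/subsetPset => w; exact: exits_mono.
  rewrite -(cvg_lim _ cv)//; apply: lime_le.
    by apply/cvg_ex; exists (Pr (B j K)).
  apply: nearW => n /=.
  apply: (le_trans (maximal_inequality _ _ _ (h_pred K) (h_mean0 K) (h_le K)
    (eps0 j) n)).
  by rewrite lee_fin ler_wpM2r// invr_ge0 sqr_ge0.
pose N j := \bigcap_K B j K.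
have N0 j : Pr.-negligible (N j).
  have mN : measurable (N j) by exact: bigcapT_measurable.
  apply/negligibleP => //; apply/eqP; rewrite eq_le measure_ge0 andbT.
  apply/lee_addgt0Pr => e e0; rewrite add0e.
  (* [K] is taken so late that the tail divided by [eps j ^+ 2] is at most [e]. *)
  have /cvgrPdist_le/(_ (e * eps j ^+ 2)) := c_cvg.
  case=> [|K _ /(_ K (leqnn K)) SK]; first by rewrite mulr_gt0 ?exprn_gt0.
  apply: (@le_trans _ _ (Pr (B j K))).
    by rewrite le_measure ?inE// => w; apply.
  rewrite (le_trans (B_le j K))// lee_fin ler_pdivrMr ?exprn_gt0//.
  by rewrite (le_trans (ler_norm _)).
apply: negligibleS (negligible_bigcup N0) => w /= ncv.
apply: contrapT => nN; apply: ncv; apply/cauchy_cvgP/cauchy_exP => e e0.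
have [j je] : exists j, eps j < e.
  have [j _ /(_ j (leqnn j))] := near_infty_natSinv_lt (PosNum e0).
  by exists j.
have [K nB] : exists K, ~ B j K w.
  by apply: contrapT => nK; apply: nN; exists j => // K _;
    apply: contrapT => nB; apply: nK; exists K.
exists (series (fun k => g (path w) k (X k w)) K).
exists K => // m /= Km; rewrite /ball /= distrC.
rewrite (lt_trans _ je)// ltNge; apply/negP => le; apply: nB; exists m => //.
(* With the first [K] increments silenced, the partial sum up to [m] is the difference of the
   original partial sums at [m] and [K]. *)
apply: (exits_partial_sum _ _ m _ _ _ m) => //; rewrite add0r add0n.
rewrite (big_cat_nat (leq0n K) Km)//= [X in X + _]big_nat big1 ?add0r.
  rewrite (eq_big_nat _ _ (F2 := fun k => g (path w) k (X k w))); last first.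
    by move=> i /andP[Ki _]; rewrite /h ltnNge Ki.
  move: le; rewrite /series /= (big_cat_nat (leq0n K) Km)//=.
  by rewrite addrAC subrr add0r.
by move=> i /= iK; rewrite /h iK.
Qed.

End AdaptedNoise.

(** * Bellman operator, bounded iterates and their noise *)

Section FiniteMDP.
Context {R : realType} {S A : finType}.
Implicit Types (f g : A -> R) (Q : S -> A -> R).

(* [Order.TTheory] has a lemma of the same name. *)
Local Notation maxA := Defs.maxA.

(** The sign of [c] serves the empty action set, where both maxima take the default value 0. *)
Lemma maxA_le_add f g c : 0 <= c -> (forall a, f a <= g a + c) ->
  maxA f <= maxA g + c.
Proof.
rewrite /Defs.maxA => c0 fg; case: pickP => [a0 _|_]; last by rewrite add0r.
have le a : f a <= \big[Num.max/g a0]_i g i + c.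
  by rewrite (le_trans (fg a))// lerD2r; exact: le_bigmax.
exact: bigmax_le.
Qed.

Lemma maxA_lipschitz f g c : 0 <= c -> (forall a, `|f a - g a| <= c) ->
  `|maxA f - maxA g| <= c.
Proof.
move=> c0 fg; rewrite ler_distl; apply/andP; split; last first.
  by apply: maxA_le_add => // a; have := fg a; rewrite ler_distl => /andP[].
rewrite lerBlDr; apply: maxA_le_add => // a.
by have := fg a; rewrite ler_distl lerBlDr => /andP[].
Qed.

Lemma maxA0 : maxA (fun _ : A => 0 : R) = 0.
Proof.
rewrite /Defs.maxA; case: pickP => // a0 _.
by elim/big_ind: _ => // x y -> ->; rewrite maxxx.
Qed.

Lemma maxA_norm_le f c : 0 <= c -> (forall a, `|f a| <= c) -> `|maxA f| <= c.
Proof.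
move=> c0 fc; rewrite -[maxA f]subr0 -maxA0.
by apply: maxA_lipschitz => // a; rewrite subr0.
Qed.

Lemma finite_norm_bounded {I : finType} (f : I -> R) :
  exists2 M, 0 <= M & forall i, `|f i| <= M.
Proof.
exists (\sum_i `|f i|) => [|i]; first exact: sumr_ge0.
by rewrite (bigD1 i)//= lerDl sumr_ge0.
Qed.

Variables (P r : S -> A -> S -> R) (gamma beta : R) (p : S -> R) (b : S -> A -> R).
Variables (alpha : nat -> R) (QA0 QB0 : S -> A -> R).
Hypothesis P_ge0 : forall s a s', 0 <= P s a s'.
Hypothesis P_sum1 : forall s a, \sum_s' P s a s' = 1.
Hypothesis gamma_ge0 : 0 <= gamma.
Hypothesis gamma_lt1 : gamma < 1.
Hypothesis beta_gt0 : 0 < beta.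
Hypothesis p_ge0 : forall s, 0 <= p s.
Hypothesis p_sum1 : \sum_s p s = 1.
Hypothesis b_ge0 : forall s a, 0 <= b s a.
Hypothesis b_sum1 : forall s, \sum_a b s a = 1.
Hypothesis alpha01 : forall k, 0 <= alpha k <= 1.
Hypothesis alpha_cvg0 : alpha @ \oo --> 0.

Definition bellman Q s a : R :=
  \sum_s' P s a s' * (r s a s' + gamma * maxA (Q s')).

Lemma bellman_lipschitz Q Q' c s a : 0 <= c ->
  (forall u v, `|Q u v - Q' u v| <= c) ->
  `|bellman Q s a - bellman Q' s a| <= gamma * c.
Proof.
move=> c0 QQ'; rewrite /bellman -sumrB.
apply: (le_trans (ler_norm_sum _ _ _)).
rewrite -[leRHS]mul1r -(P_sum1 s a) mulr_suml ler_sum// => s' _.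
rewrite -mulrBr normrM ger0_norm// ler_wpM2l//.
rewrite opprD addrACA subrr add0r -mulrBr normrM ger0_norm// ler_wpM2l//.
exact: maxA_lipschitz.
Qed.

(** [rm] bounds the rewards and is chosen before [M], so that an invariant radius can be solved for
    later. *)
Lemma target_bounded : exists2 rm, 0 <= rm & forall f M s a s', 0 <= M ->
  (forall u, `|f u| <= M) -> `|r s a s' + gamma * maxA f| <= rm + gamma * M.
Proof.
have [rm rm0 r_le] :=
  finite_norm_bounded (fun y : S * A * S => r y.1.1 y.1.2 y.2).
exists rm => // f M s a s' M0 fM.
rewrite (le_trans (ler_normD _ _))// lerD//; first exact: r_le (s, a, s').
by rewrite normrM ger0_norm// ler_wpM2l// maxA_norm_le.
Qed.

(** As a real factor of the step size, this indicator turns the asynchronous update into one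
    recursion valid for every entry at every time. *)
Definition visit (s : S) (a : A) (y : S * A * S) : R :=
  ((s == y.1.1) && (a == y.1.2))%:R.

Lemma visit01 s a y : 0 <= visit s a y <= 1.
Proof. by rewrite ler0n lern1 leq_b1. Qed.

Lemma triple_law_ge0 y : 0 <= triple_law p b P y.
Proof. by case: y => [[s a] s'] /=; rewrite mulr_ge0 ?mulr_ge0. Qed.

Lemma sum_triple (F : S * A * S -> R) :
  \sum_y F y = \sum_s \sum_a \sum_s' F (s, a, s').
Proof. by rewrite !pair_bigA /=; apply: eq_bigr => -[[s a] s']. Qed.

Lemma triple_law_sum1 : \sum_y triple_law p b P y = 1.
Proof.
rewrite sum_triple -[RHS]p_sum1; apply: eq_bigr => s _.
rewrite -[RHS]mulr1 -(b_sum1 s) mulr_sumr; apply: eq_bigr => a _.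
by rewrite -mulr_sumr P_sum1 mulr1.
Qed.

(** Conditioning on the visited pair: both the centring of the noise and the mean visit frequency
    are instances. *)
Lemma triple_law_visit s a (F : S -> R) :
  \sum_y triple_law p b P y * (visit s a y * F y.2) =
  p s * b s a * \sum_s' P s a s' * F s'.
Proof.
rewrite sum_triple (bigD1 s)//= (bigD1 a)//= [X in _ + X + _]big1 ?addr0.
- rewrite [X in _ + X]big1 ?addr0 => [|u us].
    rewrite mulr_sumr; apply: eq_bigr => s' _.
    by rewrite /visit /= !eqxx mul1r !mulrA.
  apply: big1 => v _; apply: big1 => s' _.
  by rewrite /visit /= eq_sym (negbTE us) mul0r mulr0.
- move=> v va; apply: big1 => s' _.
  by rewrite /visit /= [a == v]eq_sym (negbTE va) andbF mul0r mulr0.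
Qed.

Local Notation iterates := (agt2 r gamma beta alpha QA0 QB0).

Lemma agt2_predictable x x' k : (forall j, (j < k)%N -> x j = x' j) ->
  iterates x k = iterates x' k.
Proof.
elim: k => //= k IH xx'; rewrite xx'// IH// => j jk.
by apply: xx'; rewrite ltnS ltnW.
Qed.

Lemma agt2S_A x k s a :
  (iterates x k.+1).1 s a = (iterates x k).1 s a + alpha k * visit s a (x k) *
    (r s a (x k).2 + gamma * maxA ((iterates x k).2 (x k).2)
     - (iterates x k).1 s a).
Proof.
rewrite /= /visit; case: (x k) => [[u v] s'] /=.
case: (iterates x k) => QA QB /=.
by case: andP => [[/eqP-> /eqP->]|_]; rewrite ?mulr1// mulr0 mul0r addr0.
Qed.

Lemma agt2S_B x k s a :
  (iterates x k.+1).2 s a = (iterates x k).2 s a + alpha k * visit s a (x k) *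
    beta * ((iterates x k).1 s a - (iterates x k).2 s a).
Proof.
rewrite /= /visit; case: (x k) => [[u v] s'] /=.
case: (iterates x k) => QA QB /=.
by case: andP => [[/eqP-> /eqP->]|_]; rewrite ?mulr1// mulr0 !mul0r addr0.
Qed.

(* Finitely many initial steps with [alpha k * beta > 1] may enlarge the
   iterates; afterwards every update is a convex combination. *)
Lemma agt2_bounded : exists2 M, 0 <= M & forall x k s a,
  `|(iterates x k).1 s a| <= M /\ `|(iterates x k).2 s a| <= M.
Proof.
have [rm rm0 target_le] := target_bounded.
have [K _ abK] : \forall k \near \oo, alpha k * beta <= 1.
  have /cvgrPdist_le/(_ beta^-1) := alpha_cvg0.
  case; rewrite ?invr_gt0// => K _ HK; exists K => // k /HK.
  rewrite sub0r normrN ger0_norm; last by have /andP[] := alpha01 k.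
  by rewrite -ler_pdivlMr// mul1r.
have early k : exists2 M, 0 <= M & forall x j, (j <= k)%N -> forall s a,
    `|(iterates x j).1 s a| <= M /\ `|(iterates x j).2 s a| <= M.
  elim: k => [|k [M M0 IH]].
    have [MA MA0 hA] := finite_norm_bounded (fun y : S * A => QA0 y.1 y.2).
    have [MB MB0 hB] := finite_norm_bounded (fun y : S * A => QB0 y.1 y.2).
    exists (MA + MB) => [|x j]; first exact: addr_ge0.
    rewrite leqn0 => /eqP -> s a /=; have := hA (s, a); have := hB (s, a) => /=.
    lra.
  (* In one step [QA] moves by at most target plus entry, [rm + gamma * M + M], and [QB] by at most
     [beta * (M + M)]. *)
  have M'0 : 0 <= M + (rm + gamma * M + M) by rewrite !addr_ge0// mulr_ge0.
  have M''0 : 0 <= beta * (M + M) by rewrite mulr_ge0 ?addr_ge0// ltW.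
  exists (M + (rm + gamma * M + M) + beta * (M + M)); first exact: addr_ge0.
  move=> x j; rewrite leq_eqVlt => /orP[/eqP ->|].
    move=> s a; have [QA_le QB_le] := IH x k (leqnn k) s a.
    have av : 0 <= alpha k * visit s a (x k) <= 1.
      have /andP[a0 a1] := alpha01 k; have /andP[v0 v1] := visit01 s a (x k).
      by rewrite mulr_ge0//= mulr_ile1.
    have /andP[av0 av1] := av; rewrite agt2S_A agt2S_B; split.
      rewrite (le_trans (ler_normD _ _))// normrM [`|_ * visit _ _ _|]ger0_norm//.
      apply: (@le_trans _ _ (M + (rm + gamma * M + M))); last by rewrite lerDl.
      apply: lerD => //; rewrite (le_trans (ler_piMl _ av1))//.
      rewrite (le_trans (ler_normB _ _))// lerD//.
      by apply: target_le => // u; have [] := IH x k (leqnn k) (x k).2 u.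
    rewrite (le_trans (ler_normD _ _))// !normrM [`|beta|]gtr0_norm//.
    rewrite -normrM [`|_ * visit _ _ _|]ger0_norm//.
    apply: lerD; first by rewrite (le_trans QB_le)// lerDl !addr_ge0// mulr_ge0.
    rewrite -mulrA (le_trans (ler_piMl _ av1))//.
      by rewrite mulr_ge0// ltW.
    by rewrite ler_wpM2l ?(ltW beta_gt0)// (le_trans (ler_normB _ _))// lerD.
  rewrite ltnS => jk s a; have [] := IH x j jk s a.
  have : M <= M + (rm + gamma * M + M) by rewrite lerDl !addr_ge0// mulr_ge0.
  lra.
have [M0 M00 M0_le] := early K.
(* A radius that contains the early iterates and that the targets do not leave: any
   [M >= rm / (1 - gamma)] has the second property. *)
have [M [MM0 M_stable]] : exists M, M0 <= M /\ rm + gamma * M <= M.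
  have g1 : 0 < 1 - gamma by rewrite subr_gt0.
  have rmE : rm = (1 - gamma) * (rm / (1 - gamma)).
    by rewrite mulrC divfK ?gt_eqF.
  exists (M0 + rm / (1 - gamma)); split; first by rewrite lerDl divr_ge0// ltW.
  have : gamma * M0 <= M0 by rewrite ler_piMl// ltW.
  move: (rm / _) rmE => q; lra.
exists M => [|x k]; first exact: le_trans MM0.
have M_ge0 := le_trans M00 MM0.
have [kK|Kk] := leqP k K.
  by move=> s a; have [] := M0_le x k kK s a; lra.
rewrite -(subnKC (ltnW Kk)); elim: (k - K)%N => [|n IH] s a.
  by rewrite addn0; have [] := M0_le x K (leqnn K) s a; lra.
rewrite addnS; move: (K + n)%N (leq_addr n K) IH => {}k {}Kk IH.
have [QA_le QB_le] := IH s a.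
have convex t c c' : 0 <= t <= 1 -> `|c| <= M -> `|c'| <= M ->
    `|c + t * (c' - c)| <= M.
  move=> /andP[t0 t1] cM c'M.
  rewrite [X in `|X|](_ : _ = (1 - t) * c + t * c'); last by ring.
  rewrite (le_trans (ler_normD _ _))// !normrM.
  rewrite [`|t|]ger0_norm// [`|1 - t|]ger0_norm ?subr_ge0//.
  have : t * `|c'| <= t * M by rewrite ler_wpM2l.
  have : (1 - t) * `|c| <= (1 - t) * M by rewrite ler_wpM2l// subr_ge0.
  lra.
have /andP[a0 a1] := alpha01 k; have /andP[v0 v1] := visit01 s a (x k).
rewrite agt2S_A agt2S_B; split; apply: convex => //.
- by rewrite mulr_ge0//= mulr_ile1.
- apply: le_trans M_stable; apply: target_le => // u.
  by have [] := IH (x k).2 u.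
- rewrite mulr_ge0 ?mulr_ge0//=; last exact: ltW.
  by rewrite mulrAC mulr_ile1 ?mulr_ge0 ?abK// ltW.
Qed.

(** The sampled target minus its conditional mean given the past and the pair [(s, a)], scaled by
    the effective step. *)
Definition noise s a (x : nat -> S * A * S) k (y : S * A * S) : R :=
  alpha k * (visit s a y * (r s a y.2 + gamma * maxA ((iterates x k).2 y.2)
                            - bellman (iterates x k).2 s a)).

Lemma noise_predictable s a x x' k : (forall j, (j < k)%N -> x j = x' j) ->
  noise s a x k = noise s a x' k.
Proof.
by move=> xx'; apply/funext => y; rewrite /noise (agt2_predictable _ _ _ xx').
Qed.

Lemma noise_mean0 s a x k : \sum_y triple_law p b P y * noise s a x k y = 0.
Proof.
under eq_bigr => y _ do rewrite /noise mulrCA.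
rewrite -mulr_sumr (triple_law_visit s a (fun s' =>
  r s a s' + gamma * maxA ((iterates x k).2 s') - bellman (iterates x k).2 s a)).
under eq_bigr => s' _ do rewrite mulrBr.
by rewrite sumrB -mulr_suml P_sum1 mul1r subrr !mulr0.
Qed.

(** Uniform boundedness of the iterates makes [D] independent of the path, so these bounds are
    square summable whenever [alpha] is. *)
Lemma noise_le : exists D, forall s a x k y, `|noise s a x k y| <= D * alpha k.
Proof.
have [M M0 QM] := agt2_bounded.
have [rm rm0 target_le] := target_bounded.
have QB_target_le x k s a s' :
    `|r s a s' + gamma * maxA ((iterates x k).2 s')| <= rm + gamma * M.
  by apply: target_le => // u; have [] := QM x k s' u.
exists (rm + gamma * M + (rm + gamma * M)) => s a x k y.
have /andP[a0 a1] := alpha01 k; have /andP[v0 v1] := visit01 s a y.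
rewrite /noise !normrM [`|alpha k|]ger0_norm// [leRHS]mulrC ler_wpM2l//.
rewrite [`|visit _ _ _|]ger0_norm// (le_trans (ler_piMl _ v1))//.
rewrite (le_trans (ler_normB _ _))// lerD//.
rewrite /bellman (le_trans (ler_norm_sum _ _ _))//.
rewrite -[leRHS]mul1r -(P_sum1 s a) mulr_suml ler_sum// => s' _.
by rewrite normrM ger0_norm// ler_wpM2l.
Qed.

Variable Qstar : S -> A -> R.
Hypothesis Qstar_opt : bellman_opt P r gamma Qstar.

(** * Convergence along a fixed trajectory *)

Section Pathwise.
Variable x : nat -> S * A * S.
Hypothesis visits_inf : forall s a,
  series (fun k => alpha k * visit s a (x k)) @ \oo --> +oo.
Hypothesis noise_cvg : forall s a, cvgn (series (fun k => noise s a x k (x k))).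

Let errA k s a := (iterates x k).1 s a - Qstar s a.
Let errB k s a := (iterates x k).2 s a - Qstar s a.

(** That is, the limit superior of every entry of [|err|] is at most [c]. *)
Let eventually_le (err : nat -> S -> A -> R) c :=
  forall s a e, 0 < e -> \forall k \near \oo, `|err k s a| <= c + e.

Let step01 s a k : 0 <= alpha k * visit s a (x k) <= 1.
Proof.
have /andP[a0 a1] := alpha01 k; have /andP[v0 v1] := visit01 s a (x k).
by rewrite mulr_ge0//= mulr_ile1.
Qed.

Lemma errA_le c : 0 <= c -> eventually_le errB c -> eventually_le errA (gamma * c).
Proof.
move=> c0 Bc s a e e0; have e2 : 0 < e / 2 by rewrite divr_gt0.
pose h k := bellman (iterates x k).2 s a - bellman Qstar s a.
have h_le : \forall k \near \oo, `|h k| <= gamma * (c + e / 2).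
  have [N _ HN] : \forall k \near \oo, forall u v, `|errB k u v| <= c + e / 2.
    by do 2!apply: filter_forall => ?; exact: Bc.
  exists N => // k /HN Bk; apply: bellman_lipschitz => //.
  by rewrite addr_ge0// ltW.
have [N _ HN] : \forall k \near \oo, `|errA k s a| <= gamma * (c + e / 2) + e / 2.
  apply: (@noisy_averaging_eventually_le R (fun k => alpha k * visit s a (x k))
    h (fun k => noise s a x k (x k)) (fun k => errA k s a)) => //.
    by exists 0%N => // k _; exact: step01.
  (* Adding the noise to [h] restores the sampled target; the fixed point equation supplies the
     subtracted [Qstar]. *)
  move=> k; rewrite /errA agt2S_A /h /noise.
  have -> : Qstar s a = bellman Qstar s a by exact: Qstar_opt.
  ring.
exists N => // k /HN /le_trans; apply.
have : gamma * (e / 2) <= e / 2 by rewrite ler_piMl// ltW.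
lra.
Qed.

(** [QB] follows [QA] without noise, with weights scaled by [beta]; these lie below 1 only
    eventually, as [alpha] tends to 0. *)
Lemma errB_le c : eventually_le errA c -> eventually_le errB c.
Proof.
move=> Ac s a e e0; have e2 : 0 < e / 2 by rewrite divr_gt0.
have [N _ HN] : \forall k \near \oo, `|errB k s a| <= (c + e / 2) + e / 2.
  apply: (@averaging_eventually_le R
    (fun k => alpha k * visit s a (x k) * beta)
    (fun k => errA k s a) (fun k => errB k s a)) => //.
  - have /cvgrPdist_le/(_ beta^-1) := alpha_cvg0.
    case; rewrite ?invr_gt0// => K _ HK; exists K => // k /HK.
    have /andP[a0 a1] := alpha01 k; have /andP[v0 v1] := visit01 s a (x k).
    rewrite sub0r normrN ger0_norm// -[leRHS]mul1r ler_pdivlMr// => ab1.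
    rewrite mulr_ge0 ?mulr_ge0//=; last exact: ltW.
    by rewrite mulrAC mulr_ile1 ?mulr_ge0// ltW.
  - apply/cvgryPge => B.
    have /cvgryPge/(_ (B / beta))[K _ HK] := visits_inf s a.
    exists K => // n /HK; rewrite ler_pdivrMr// /series /= mulr_suml.
    exact.
  - by move=> k; rewrite /errB /errA agt2S_B; ring.
  - exact: Ac.
by exists N => // k /HN; rewrite -addrA -splitr.
Qed.

Lemma pathwise_cvg s a :
  (fun k => (iterates x k).1 s a) @ \oo --> Qstar s a /\
  (fun k => (iterates x k).2 s a) @ \oo --> Qstar s a.
Proof.
have [M M0 QM] := agt2_bounded.
have [Ms Ms0 Qs_le] := finite_norm_bounded (fun y : S * A => Qstar y.1 y.2).
have c0 : 0 <= M + Ms by exact: addr_ge0.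
(* Each pass through [QA] and back gains a factor [gamma], starting from the crude bound by
   boundedness. *)
have geom n : eventually_le errB (gamma ^+ n * (M + Ms)).
  elim: n => [|n IH].
    move=> u v e e0; exists 0%N => // k _; rewrite expr0 mul1r.
    have [_ ?] := QM x k u v; have := Qs_le (u, v) => /= ?.
    have := ler_normB ((iterates x k).2 u v) (Qstar u v); rewrite /errB; lra.
  rewrite exprS -mulrA; apply/errB_le/errA_le => //.
  by rewrite mulr_ge0// exprn_ge0.
have B0 : eventually_le errB 0.
  move=> u v e e0; have e2 : 0 < e / 2 by rewrite divr_gt0.
  have : (fun n => gamma ^+ n * (M + Ms)) @ \oo --> (0 : R).
    rewrite -[X in _ --> X](mul0r (M + Ms)); apply: cvgMr_tmp.
    by apply: cvg_expr; rewrite ger0_norm.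
  move=> /cvgrPdist_le/(_ _ e2)[n _ /(_ n (leqnn n))].
  rewrite sub0r normrN => /(le_trans (ler_norm _)) gn.
  have [N _ HN] := geom n u v _ e2; exists N => // k /HN; lra.
have A0 : eventually_le errA 0 by rewrite -(mulr0 gamma); exact: errA_le.
split; apply/cvgrPdist_le => e e0.
- have [N _ HN] := A0 s a e e0; exists N => // k /HN.
  by rewrite add0r distrC.
- have [N _ HN] := B0 s a e e0; exists N => // k /HN.
  by rewrite add0r distrC.
Qed.

End Pathwise.

End FiniteMDP.

(** * From almost sure series convergence to the theorem *)

Lemma cvg_visits_pinfty {R : realType} (alpha v : R^nat) (q : R) : 0 < q ->
  series alpha @ \oo --> +oo ->
  cvgn (series (fun k => alpha k * (v k - q))) ->
  series (fun k => alpha k * v k) @ \oo --> +oo.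
Proof.
move=> q0 suma cv; apply/cvgryPge => B.
set l := limn (series (fun k => alpha k * (v k - q))) in cv *.
have /cvgrPdist_le/(_ 1 ltr01)[N _ HN] := cv.
(* The centred series is eventually at least [l - 1], so [q] times the sum of [alpha] has to make up
   [B - l + 1]. *)
have /cvgryPge/(_ ((B - l + 1) / q))[K _ HK] := suma.
exists (maxn N K) => // n /=; rewrite geq_max => /andP[/HN Nn /HK].
rewrite ler_pdivrMr// => Kn.
have -> : series (fun k => alpha k * v k) n =
    series (fun k => alpha k * (v k - q)) n + series alpha n * q.
  rewrite /series /= mulr_suml -big_split /=; apply: eq_bigr => k _; ring.
move: Nn; rewrite ler_distl => /andP[_]; rewrite -/l; lra.
Qed.

Theorem theorem3 (R : realType) (S A : finType)
  (P : S -> A -> S -> R) (r : S -> A -> S -> R) (gamma beta : R)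
  (Qstar : S -> A -> R) (p : S -> R) (b : S -> A -> R)
  (d : measure_display) (T : measurableType d) (Pr : probability T R)
  (X : nat -> T -> S * A * S) (alpha : nat -> R) (QA0 QB0 : S -> A -> R) :
  (forall s a s', 0 <= P s a s') -> (forall s a, \sum_(s' : S) P s a s' = 1) ->
  0 <= gamma -> gamma < 1 ->
  bellman_opt P r gamma Qstar ->
  0 < beta ->
  (forall s, 0 <= p s) -> \sum_(s : S) p s = 1 ->
  (forall s a, 0 <= b s a) -> (forall s, \sum_(a : A) b s a = 1) ->
  (forall s a, 0 < p s * b s a) ->
  iid_with_law Pr X (triple_law p b P) ->
  (forall k, 0 <= alpha k <= 1) ->
  series alpha @ \oo --> +oo ->
  cvgn (series (fun k => alpha k ^+ 2)) ->
  {ae Pr, forall w, forall s a,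
     (fun k => (agt2 r gamma beta alpha QA0 QB0 (fun j => X j w) k).1 s a)
       @ \oo --> Qstar s a /\
     (fun k => (agt2 r gamma beta alpha QA0 QB0 (fun j => X j w) k).2 s a)
       @ \oo --> Qstar s a}.
Proof.
move=> P0 P1 g0 g1 Qopt beta0 p0 p1 b0 b1 d0 [measX lawX] a01 suma suma2.
pose mu := triple_law p b P.
have mu0 : forall y, 0 <= mu y by exact: triple_law_ge0.
have mu1 : \sum_y mu y = 1 by exact: triple_law_sum1.
have alpha_cvg0 : alpha @ \oo --> (0 : R).
  apply/cvgrPdist_le => e e0.
  have /cvgrPdist_le/(_ (e ^+ 2)) := cvg_series_cvg_0 suma2.
  case; rewrite ?exprn_gt0// => N _ HN; exists N => // k /HN.
  have /andP[ak0 _] := a01 k.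
  rewrite !sub0r !normrN ger0_norm ?sqr_ge0// ger0_norm//.
  by rewrite ler_sqr ?nnegrE// ltW.
have scaled D : cvgn (series (fun k => (D * alpha k) ^+ 2)).
  rewrite (_ : (fun k => _) = D ^+ 2 *: (fun k => alpha k ^+ 2)).
    exact: is_cvg_seriesZ.
  by apply/funext => k; rewrite exprMn.
have ae_noise s a : {ae Pr, forall w, cvgn (series (fun k =>
    noise P r gamma beta alpha QA0 QB0 s a (fun j => X j w) k (X k w)))}.
  have [D noiseD] := @noise_le R S A P r gamma beta alpha QA0 QB0 P0 P1 g0 g1
    beta0 a01 alpha_cvg0.
  apply: (@ae_cvg_adapted_series R d T Pr _ X mu measX lawX mu0 mu1 _
    (fun k => D * alpha k)) => //.
  - exact: noise_predictable.
  - exact: noise_mean0.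
(* Visits centred at their frequency [p s * b s a]: this increment ignores the past and is at most
   [1 + p s * b s a] times the step. *)
have ae_visit s a : {ae Pr, forall w, cvgn (series (fun k =>
    alpha k * (visit s a (X k w) - p s * b s a)))}.
  apply: (@ae_cvg_adapted_series R d T Pr _ X mu measX lawX mu0 mu1
    (fun _ k y => alpha k * (visit s a y - p s * b s a))
    (fun k => (1 + p s * b s a) * alpha k)) => //.
  - move=> _ k; under eq_bigr => y _ do rewrite mulrCA.
    rewrite -mulr_sumr; under eq_bigr => y _ do rewrite mulrBr.
    rewrite sumrB -mulr_suml mu1 mul1r.
    have := triple_law_visit P p b s a (fun=> 1).
    under eq_bigr => y _ do rewrite mulr1.
    under [in X in _ * X]eq_bigr => y _ do rewrite mulr1.
    by rewrite P1 mulr1 => ->; rewrite subrr mulr0.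
  - move=> _ k y; have /andP[ak0 _] := a01 k.
    have /andP[v0 v1] := visit01 (R := R) s a y.
    rewrite normrM ger0_norm// mulrC ler_wpM2r// (le_trans (ler_normB _ _))//.
    by rewrite lerD// ger0_norm// ltW.
have FF : Filter (almost_everywhere Pr) by exact: ae_filter_ringOfSetsType.
(* Finitely many pairs, so one almost sure event serves them all. *)
have all_noise : {ae Pr, forall w, forall s a, cvgn (series (fun k =>
    noise P r gamma beta alpha QA0 QB0 s a (fun j => X j w) k (X k w)))}.
  by do 2!apply: filter_forall => ?; exact: ae_noise.
have all_visit : {ae Pr, forall w, forall s a, cvgn (series (fun k =>
    alpha k * (visit s a (X k w) - p s * b s a)))}.
  by do 2!apply: filter_forall => ?; exact: ae_visit.
apply: filterS2 all_visit all_noise => w visit_w noise_w s a.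
apply: pathwise_cvg => // u v.
exact: (cvg_visits_pinfty _ _ _ (d0 u v) suma (visit_w u v)).
Qed.
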